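(* For every positive integer $d$ there exists $v(d)>0$, and for every integer $p\ge d+1$ there exists an integer $r=r(p,d)$, such that the following holds. Let $\mathcal{F}$ be a finite family of convex sets in $\mathbb{R}^d$, each of diameter at least $1$, such that among any $p$ members of $\mathcal{F}$ there exist $d+1$ whose intersection has diameter at least $1$. Then there exists a family $\mathcal{C}$ of $r$ convex sets, each of diameter at least $v(d)$, such that every member of $\mathcal{F}$ contains at least one element of $\mathcal{C}$.
   Context: Diameter is with respect to the Euclidean metric. *)

(* Defs.v *)
From HB Require Import structures.
From mathcomp Require Import all_boot all_order all_algebra.
From mathcomp Require Import all_classical all_reals all_analysis.
Set Implicit Arguments. Unset Strict Implicit. Unset Printing Implicit Defensive.
Import Order.TTheory GRing.Theory Num.Theory.
Local Open Scope classical_set_scope.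
Local Open Scope ring_scope.

Definition edist (R : realType) (d : nat) (x y : 'rV[R]_d) : R :=
  Num.sqrt (\sum_(i < d) (x ord0 i - y ord0 i) ^+ 2).

(* Euclidean diameter, in the extended reals (+oo for unbounded sets, -oo for the empty set) *)
Definition diam (R : realType) (d : nat) (S : set 'rV[R]_d) : \bar R :=
  ereal_sup [set e | exists x y, S x /\ S y /\ e = (edist x y)%:E].

Definition convex_set_Rd (R : realType) (d : nat) (S : set 'rV[R]_d) : Prop :=
  forall x y, S x -> S y -> forall t : R, 0 <= t -> t <= 1 ->
    S (t *: x + (1 - t) *: y).

Definition bigcapF (R : realType) (d : nat) (I : finType) (F : I -> set 'rV[R]_d)
  (K : {set I}) : set 'rV[R]_d :=
  [set x | forall i, i \in K -> F i x].

(* Main.v *)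
(* A set of diameter at least 1 has extent at least 1/d in some coordinate direction, so the theorem
   reduces to piercing the sets by boundedly many pairs (x, y) with |x_i - y_i| >= v for some i. As in
   the Alon-Kleitman argument it suffices to find, for all weights on the sets, one such pair lying in
   a positive fraction of the weight: multiplicative weights then give a fractional transversal by
   pairs, and a weak epsilon-net in R^(2d) turns it into a bounded one.

   Such a heavy pair only requires (d+1)-fold intersections. Let p(D) be the point nearest to the origin
   in the intersection of D. By Helly's theorem p(T) = p(T \ {e}) for some e in T when |T| = d+1. By
   Ramsey's theorem, among many sets there are d+1 classes of two sets all of whose rainbow
   intersections T are wide in the same direction i, to the same side of p(T), and with e(T) always
   in the same class E. Then both members of E contain p(D) for every rainbow D avoiding E. If the
   p(D) differ by at least v in direction i, this is a pair. Otherwise all rainbow intersections cross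
   d+1 common levels x_i = const with spacing v; the colourful Helly theorem in each level, of
   dimension d-1, makes one of the d other classes intersect there, and by pigeonhole one class
   intersects in two levels. In both cases the pair lies in a set F and is determined, in boundedly
   many ways, by the sets other than F, so averaging over all tuples yields one pair that lies in a
   positive fraction of the family. *)
Require Import Defs.
From HB Require Import structures.
From mathcomp Require Import all_boot all_order all_algebra.
From mathcomp Require Import all_classical all_reals all_analysis.
From mathcomp Require Import zify ring lra.
Import Order.TTheory GRing.Theory Num.Theory.
Import numFieldNormedType.Exports.
Local Open Scope classical_set_scope.
Local Open Scope ring_scope.
Set Implicit Arguments.
Unset Strict Implicit.
Unset Printing Implicit Defensive.

(** * Ramsey, multiplicative weights, averaging *)

Lemma count_pigeonhole (T : Type) (C : finType) (f : T -> C) (s : seq T) (m : nat) :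
  (#|C| * m < size s)%N -> exists c, (m < count (fun x => f x == c) s)%N.
Proof.
move=> hs; apply/not_existsP => h.
have hsum : size s = (\sum_c count (fun x => f x == c) s)%N.
  elim: s {hs h} => [|x s IH]; first by rewrite big1.
  by rewrite /= big_split /= -IH (bigD1 (f x)) //= eqxx big1 ?addn0 // => c;
    rewrite eq_sym => /negbTE ->.
move: hs; rewrite hsum ltnNge -sum_nat_const => /negP; apply.
by apply: leq_sum => c _; rewrite leqNgt; apply/negP/h.
Qed.

(** The prehomogeneous sequences of the Erdős-Rado proof of Ramsey's theorem: the colour attached to
    [x] is valid for [x] followed by any [r] later elements. *)
Fixpoint end_homogeneous (T : eqType) (C : Type) (Col : C -> seq T -> Prop) (r : nat)
    (w : seq (T * C)) : Prop :=
  if w is (x, c) :: w' then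
    (forall t, subseq t (map fst w') -> size t = r -> Col c (x :: t)) /\
    end_homogeneous Col r w'
  else True.

Lemma end_homogeneous_filter (T : eqType) (C : eqType) (Col : C -> seq T -> Prop) r w c t :
  end_homogeneous Col r w -> subseq t (map fst [seq p <- w | p.2 == c]) ->
  size t = r.+1 -> Col c t.
Proof.
elim: w t => [|[x c'] w IH] t /=; first by move=> _ /eqP ->.
move=> [h1 h2]; case: eqP h1 => [->|_] h1; last exact: IH.
case: t => [|y t] //=; case: (y =P x) => [-> ht [st]|_ ht st]; last exact: IH.
apply: h1 => //; apply: subseq_trans ht _; apply: map_subseq; exact: filter_subseq.
Qed.

(* Colours are given by a relation: a subsequence may have several. *)
Lemma ramsey (C : finType) (r M : nat) : exists N, forall (T : eqType) (s : seq T)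
    (Col : C -> seq T -> Prop), (N <= size s)%N ->
  (forall t, subseq t s -> size t = r -> exists c, Col c t) ->
  exists c u, subseq u s /\ size u = M /\ forall t, subseq t u -> size t = r -> Col c t.
Proof.
elim: r M => [|r IH] M.
  exists M => T s Col hs hC; have [c hc] := hC [::] (sub0seq s) erefl.
  exists c, (take M s); split; first exact: take_subseq.
  by split=> [|t _ /size0nil ->//]; rewrite size_takel.
have inner L : exists N, forall (T : eqType) (s : seq T)
    (Col : C -> seq T -> Prop), (N <= size s)%N ->
    (forall t, subseq t s -> size t = r.+1 -> exists c, Col c t) ->
    exists w, [/\ size w = L, subseq (map fst w) s & end_homogeneous Col r w].
  elim: L => [|L [N hN]]; first by exists 0%N => T s Col _ _; exists [::]; split=> //; rewrite sub0seq.
  have [N' hN'] := IH N; exists N'.+1 => T [|x s] Col //= hs hC.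
  have [|c [u [us [su hu]]]] := hN' T s (fun c t => Col c (x :: t)) hs.
    by move=> t ts st; apply: hC; rewrite /= ?eqxx ?st.
  have [||w [sw ws hw]] := hN T u Col; first by rewrite su.
    move=> t tu st; apply: hC => //; apply: subseq_trans (subseq_cons _ _).
    exact: subseq_trans tu us.
  exists ((x, c) :: w); split=> /=; first by rewrite sw.
    by rewrite eqxx; apply: subseq_trans ws us.
  split=> // t tw; apply: hu; exact: subseq_trans tw ws.
have [N hN] := inner (#|C| * M).+1; exists N => T s Col hs hC.
have [w [sw ws hw]] := hN T s Col hs hC.
have [c hc] : exists c, (M < count (fun p => p.2 == c) w)%N.
  by apply: count_pigeonhole; rewrite sw.
exists c, (take M (map fst [seq p <- w | p.2 == c])); split.
  apply: subseq_trans (take_subseq _ _) _; apply: subseq_trans ws.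
  apply: map_subseq; exact: filter_subseq.
split; first by rewrite size_takel // size_map size_filter ltnW.
by move=> t tu; apply: end_homogeneous_filter hw _; exact: subseq_trans tu (take_subseq _ _).
Qed.

(* The multiplicative weights argument: each chosen point halves the weights of the sets it hits, so
   the total weight decays geometrically, while it dominates the weight of any rarely hit set. *)
Lemma fractional_transversal (I : finType) (X : Type) (hit : X -> I -> bool) (Q : nat) :
  (0 < #|I|)%N -> (0 < Q)%N ->
  (forall w : I -> nat, (0 < \sum_i w i)%N ->
     exists x, (\sum_i w i <= Q * \sum_(i | hit x i) w i)%N) ->
  exists Z : seq X, (0 < size Z)%N /\
    forall i, (size Z <= 4 * Q * count (hit^~ i) Z)%N.
Proof.
move=> I0 Q0 H.
(* Rescaled to stay in the naturals: a miss doubles the weight and a hit keeps it, instead of a hit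
   halving it. *)
pose W (Z : seq X) := (\sum_i 2 ^ (size Z - count (hit^~ i) Z))%N.
have step T : exists Z, size Z = T /\ (Q ^ T * W Z <= (2 * Q - 1) ^ T * #|I|)%N.
  elim: T => [|T [Z [sZ hZ]]].
    by exists [::]; split=> //; rewrite /W /= !expn0 !mul1n sum1_card.
  have W0 : (0 < W Z)%N.
    by rewrite /W; have /card_gt0P[i _] := I0; rewrite (bigD1 i) //= ltn_addr // expn_gt0.
  have [x hx] := H _ W0; exists (x :: Z); split; first by rewrite /= sZ.
  have e : (W (x :: Z) + \sum_(i | hit x i) 2 ^ (size Z - count (hit^~ i) Z) = 2 * W Z)%N.
    rewrite /W (bigID (hit x)) /= [in RHS](bigID (hit x)) /= mulnDr.
    rewrite addnAC; congr (_ + _)%N.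
      rewrite mul2n -addnn; congr (_ + _)%N.
      by apply: eq_bigr => i ->; rewrite add1n subSS.
    rewrite big_distrr /=; apply: eq_bigr => i /negbTE ->.
    by rewrite add0n subSn ?count_size // expnS.
  rewrite -/(W Z) in hx.
  have h1 : (Q * W (x :: Z) <= (2 * Q - 1) * W Z)%N.
    have : (Q * W (x :: Z) + Q * \sum_(i | hit x i) 2 ^ (size Z - count (hit^~ i) Z)
           = Q * (2 * W Z))%N by rewrite -mulnDr e.
    nia.
  rewrite !expnS -mulnA.
  have -> : (Q * (Q ^ T * W (x :: Z)) = Q ^ T * (Q * W (x :: Z)))%N by lia.
  apply: (@leq_trans (Q ^ T * ((2 * Q - 1) * W Z))%N); first by rewrite leq_mul2l h1 orbT.
  have -> : (Q ^ T * ((2 * Q - 1) * W Z) = (2 * Q - 1) * (Q ^ T * W Z))%N by lia.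
  by rewrite -mulnA leq_mul2l hZ orbT.
set n := #|I| in I0 step *.
(* With T = 4Qn, Bernoulli's inequality gives (2Q / (2Q - 1))^T >= 2^(2n), so the decay forces
   2^(2n) <= 2^h n <= 2^(h + n). Hence h >= n = T / (4Q). *)
have [Z [sZ hZ]] := step (2 * Q * (2 * n))%N.
exists Z; split; first by rewrite sZ !muln_gt0 Q0 I0.
move=> i; set h := count _ Z; set T := size Z in sZ *.
have hT : (h <= T)%N by rewrite count_size.
have h1 : (2 ^ (T - h) <= W Z)%N by rewrite /W (bigD1 i) //= leq_addr.
have h2 : ((2 * Q) ^ T <= 2 ^ h * ((2 * Q - 1) ^ T * n))%N.
  rewrite expnMn -{1}(subnKC hT) expnD -mulnA leq_mul2l; apply/orP; right.
  rewrite mulnC; apply: leq_trans; last by rewrite sZ; exact: hZ.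
  by rewrite sZ leq_mul2l -?sZ h1 orbT.
have bern a : (2 * a ^ a.+1 <= a.+1 ^ a.+1)%N.
  have gen k : (a ^ k.+1 + k.+1 * a ^ k <= a.+1 ^ k.+1)%N.
    elim: k => [|k IHk]; first by rewrite !expn1 expn0; lia.
    rewrite [(a.+1 ^ k.+2)%N]expnS; apply: leq_trans (leq_mul (leqnn _) IHk).
    rewrite ![(a ^ _.+1)%N]expnS; nia.
  by apply: leq_trans (gen a); rewrite expnS; nia.
have h3 : (2 ^ (2 * n) * (2 * Q - 1) ^ T <= (2 * Q) ^ T)%N.
  rewrite sZ !(expnM _ (2 * Q)) -expnMn leq_exp2r; last by lia.
  by have := bern (2 * Q - 1)%N; have -> : (2 * Q - 1).+1 = (2 * Q)%N by lia.
have h4 : (2 ^ (2 * n) <= 2 ^ (h + n))%N.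
  have pos : (0 < (2 * Q - 1) ^ T)%N by rewrite expn_gt0; apply/orP; left; lia.
  rewrite -(leq_pmul2r pos); apply: leq_trans h3 _; apply: leq_trans h2 _.
  rewrite mulnCA mulnC expnD leq_mul2r; apply/orP; right.
  by rewrite leq_mul2l ltnW ?orbT // ltn_expl.
move: h4; rewrite leq_exp2l // sZ => h4; nia.
Qed.

Definition upd (P J : finType) (g : {ffun P -> J}) (f : P) (j : J) : {ffun P -> J} :=
  [ffun k => if k == f then j else g k].

(* Double counting over the involution (g, j) |-> (upd g f j, g f). *)
Lemma upd_average (P J Q : finType) (pos : Q -> P) (ok : Q -> pred {ffun P -> J}) :
  (0 < #|J|)%N -> (forall g, exists q, ok q g) ->
  exists q g, (#|J| <= #|Q| * #|[pred j | ok q (upd g (pos q) j)]|)%N.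
Proof.
move=> J0 H; apply: contrapT => /forallNP h.
have {}h q g : (#|Q| * #|[pred j | ok q (upd g (pos q) j)]| < #|J|)%N.
  by rewrite ltnNge; apply/negP => h'; apply: (h q); exists g.
have /card_gt0P[j0 _] := J0; pose g0 : {ffun P -> J} := [ffun _ => j0].
have [q0 _] := H g0.
have dc q : (\sum_g #|[pred j | ok q (upd g (pos q) j)]| = \sum_g #|J| * ok q g)%N.
  under eq_bigr do rewrite -sum1_card big_mkcond /=.
  under [RHS]eq_bigr do rewrite -sum_nat_const.
  rewrite !pair_big /=.
  pose th (p : {ffun P -> J} * J) := (upd p.1 (pos q) p.2, p.1 (pos q)).
  have thK : involutive th.
    move=> [g j]; rewrite /th /=; congr pair; last by rewrite ffunE eqxx.
    by apply/ffunP => k; rewrite !ffunE; case: eqP => [->|].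
  rewrite [RHS](reindex_inj (inv_inj thK)) /=; apply: eq_bigr => p _.
  by rewrite unfold_in /=; case: (ok _ _).
have l1 : (\sum_q \sum_g (#|Q| * #|[pred j | ok q (upd g (pos q) j)]|).+1 <=
           \sum_(q : Q) \sum_(g : {ffun P -> J}) #|J|)%N.
  by apply: leq_sum => q _; apply: leq_sum => g _; exact: h.
have l2 : (\sum_q \sum_g #|Q| * #|[pred j | ok q (upd g (pos q) j)]| <
    \sum_q \sum_g (#|Q| * #|[pred j | ok q (upd g (pos q) j)]|).+1)%N.
  rewrite -subn_gt0 -sumnB => [|q _]; last by apply: leq_sum.
  rewrite (bigD1 q0) //= ltn_addr // -sumnB // (bigD1 g0) //= ltn_addr // subn_gt0 //.
have := leq_trans l2 l1; rewrite ltnNge => /negP; apply.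
under [X in (_ <= X)%N]eq_bigr do rewrite -big_distrr /= dc -big_distrr /=.
rewrite -big_distrr /= -big_distrr /= !sum_nat_const leq_mul2l mulnC.
rewrite leq_mul2l; apply/orP; right; apply/orP; right.
rewrite exchange_big /= -sum1_card; apply: leq_sum => g _.
by have [q hq] := H g; rewrite (bigD1 q) //= hq.
Qed.

(** * Weak epsilon-nets *)

Lemma count_allpairs_ge (S T U : Type) (f : S -> T -> U) (a : pred S) (b : pred T)
    (c : pred U) (s : seq S) (t : seq T) :
  (forall x y, a x -> b y -> c (f x y)) ->
  (count a s * count b t <= count c [seq f x y | x <- s, y <- t])%N.
Proof.
move=> h; elim: s => [|x s IH] //=; rewrite count_cat mulnDl leq_add //.
case ax: (a x); rewrite ?mul0n // mul1n count_map.
by apply: sub_count => y; exact: h.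
Qed.

Lemma weak_net_arith (h hL hU n s : nat) : (hL + hU = h + h)%N ->
  (2 ^ s.+1 * n <= 3 ^ s.+1 * h)%N -> (3 ^ s * hL < 2 ^ s * n)%N ->
  (3 ^ s * hU < 2 ^ s * n)%N ->
  (2 ^ (2 * s + 6) * (n * n) <= 3 ^ (2 * s + 6) * (hL * hU))%N.
Proof.
rewrite !(expnS _ s) !(expnD _ (2 * s) 6) !(expnM _ 2 s) !(expnAC _ 2 s).
move: (2 ^ s)%N (3 ^ s)%N => b a e h1 h2 h3.
have l1 : (b * n <= 3 * a * hL)%N by nia.
have l2 : (b * n <= 3 * a * hU)%N by nia.
have := leq_mul l1 l2.
have -> : (b * n * (b * n) = b ^ 2 * (n * n))%N by lia.
have -> : (3 * a * hL * (3 * a * hU) = 9 * (a ^ 2 * (hL * hU)))%N by lia.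
rewrite -!mulnA; nia.
Qed.

Lemma segment_level (R : realType) (a b t : R) : a <= t -> t <= b ->
  let r := (b - t) / (b - a) in 0 <= r /\ r <= 1 /\ r * a + (1 - r) * b = t.
Proof.
move=> at_ tb r; have [ab|ab] := eqVneq a b.
  rewrite /r -ab subrr invr0 mulr0; split=> //; split=> //.
  by rewrite mul0r add0r subr0 mul1r; lra.
have ba : 0 < b - a by rewrite subr_gt0 lt_neqAle ab (le_trans at_).
split; first by apply: divr_ge0; lra.
split; first by rewrite ler_pdivrMr // mul1r; lra.
by rewrite /r; field; rewrite gt_eqF.
Qed.

(* Weak epsilon-nets, the density being (2/3)^s. Split the points (taken twice) into halves by a level
   of a free coordinate: either C is 3/2 times denser in one half, or it is dense in both and
   contains many of the points where segments joining the halves cross the level. *)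
Lemma weak_net (R : realType) (D m s : nat) : (m <= D)%N -> exists r : nat,
  forall P : seq 'rV[R]_D, (0 < size P)%N ->
  (forall x y, x \in P -> y \in P -> forall j : 'I_D, (m <= j)%N -> x ord0 j = y ord0 j) ->
  exists N : seq 'rV[R]_D, (size N <= r)%N /\
  forall C : set 'rV[R]_D, convex_set_Rd C ->
    (2 ^ s * size P <= 3 ^ s * count (fun x => `[< C x >]) P)%N ->
    exists x, x \in N /\ C x.
Proof.
elim: m s => [|m IHm] s mD.
  exists 1%N => -[//|x0 P] _ hP; exists [:: x0]; split=> // C _ hC.
  have : has (fun x => `[< C x >]) (x0 :: P).
    rewrite has_count lt0n; apply: contraL hC => /eqP ->.
    by rewrite muln0 -ltnNge muln_gt0 expn_gt0.
  move=> /hasP[x xP /asboolP Cx]; exists x0; rewrite inE eqxx; split=> //.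
  suff -> : x0 = x by [].
  by apply/rowP => j; apply: hP; rewrite // inE eqxx.
elim: s => [|s [r1 IHs]].
  exists 1%N => -[//|x0 P] _ hP; exists [:: x0]; split=> // C _.
  rewrite !expn0 !mul1n => hC; exists x0; rewrite inE eqxx; split=> //.
  have /eqP : count (fun x => `[< C x >]) (x0 :: P) = size (x0 :: P).
    by apply/eqP; rewrite eqn_leq hC count_size.
  by rewrite -all_count => /andP[/asboolP].
have [r2 IH2] := IHm (2 * s + 6)%N (ltnW mD).
exists (r1 + r1 + r2)%N => P P0 hP.
pose jm := Ordinal mD; pose le := [rel x y : 'rV[R]_D | x ord0 jm <= y ord0 jm].
pose S := sort le (P ++ P); set n := size P in P0 *.
have sS : size S = (n + n)%N by rewrite size_sort size_cat.
pose L := take n S; pose U := drop n S.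
have sL : size L = n by rewrite size_takel // sS leq_addr.
have sU : size U = n by rewrite size_drop sS addnK.
have memS x : x \in S -> x \in P by rewrite mem_sort mem_cat orbb.
have memL x : x \in L -> x \in P by move=> /mem_take/memS.
have memU x : x \in U -> x \in P by move=> /mem_drop/memS.
have letr : transitive le by move=> x y z; exact: le_trans.
have : pairwise le (L ++ U).
  rewrite cat_take_drop -sorted_pairwise //; apply: sort_sorted => x y; exact: le_total.
rewrite pairwise_cat => /and3P[LU _ pU].
pose t := head 0 U ord0 jm.
have Lt l : l \in L -> l ord0 jm <= t.
  rewrite /t; case eU: U => [|u U'] /=; first by move: sU P0; rewrite eU => <-.
  by move=> lL; move/allrelP: LU => /(_ l u lL); apply; rewrite eU inE eqxx.
have tU u : u \in U -> t <= u ord0 jm.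
  rewrite /t; case eU: U => [|u' U'] //=; move: pU; rewrite eU => /andP[/allP h _].
  by rewrite inE => /predU1P[->//|/h].
pose cross (l u : 'rV[R]_D) : 'rV[R]_D :=
  let r := (u ord0 jm - t) / (u ord0 jm - l ord0 jm) in r *: l + (1 - r) *: u.
have [NL [sNL hNL]] := IHs L ltac:(by rewrite sL)
  ltac:(by move=> x y /memL xP /memL yP; exact: hP).
have [NU [sNU hNU]] := IHs U ltac:(by rewrite sU)
  ltac:(by move=> x y /memU xP /memU yP; exact: hP).
have crossj l u : l \in L -> u \in U -> cross l u ord0 jm = t.
  move=> lL uU; have [_ [_ e]] := segment_level (Lt _ lL) (tU _ uU).
  by rewrite /cross !mxE.
have crossk l u (j : 'I_D) : l \in L -> u \in U -> (m < j)%N -> cross l u ord0 j = l ord0 j.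
  move=> lL uU mj; have e : u ord0 j = l ord0 j by apply: hP => //; [exact: memU|exact: memL].
  by rewrite /cross !mxE e -mulrDl addrC subrK mul1r.
(* The crossing points agree in coordinate [m] as well, so the induction on [m] applies to them. *)
have [||NC [sNC hNC]] := IH2 [seq cross l u | l <- L, u <- U].
- by rewrite size_allpairs sL sU muln_gt0 P0.
- move=> x y /allpairsP[[l u] /= [lL uU ->]] /allpairsP[[l' u'] /= [lL' uU' ->]] j.
  rewrite leq_eqVlt => /predU1P[mj|mj].
    by have -> : j = jm by [apply: val_inj]; rewrite !crossj.
  by rewrite !crossk //; apply: hP; rewrite ?memL.
exists (NL ++ NU ++ NC); split; first by rewrite !size_cat addnA !leq_add.
move=> C cC hC; set c := (fun x => `[< C x >]) in hC.
have [hL|hL] := leqP (2 ^ s * n) (3 ^ s * count c L).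
  have [|x [xN Cx]] := hNL C cC; first by rewrite sL.
  by exists x; rewrite mem_cat xN.
have [hU|hU] := leqP (2 ^ s * n) (3 ^ s * count c U).
  have [|x [xN Cx]] := hNU C cC; first by rewrite sU.
  by exists x; rewrite !mem_cat xN orbT.
have [|x [xN Cx]] := hNC C cC; last by exists x; rewrite !mem_cat xN !orbT.
rewrite size_allpairs sL sU.
have e : (count c L + count c U = count c P + count c P)%N.
  by rewrite -!count_cat cat_take_drop; apply/permP; rewrite perm_sort.
apply: leq_trans (weak_net_arith e hC hL hU) _; rewrite leq_mul2l; apply/orP; right.
have count_in s' : count c s' = count [pred x | c x & x \in s'] s'.
  by apply: eq_in_count => x /= ->; rewrite andbT.
rewrite (count_in L) (count_in U); apply: count_allpairs_ge => l u /=.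
move=> /andP[/asboolP Cl lL] /andP[/asboolP Cu uU]; apply/asboolP.
by have [r0 [r1' _]] := segment_level (Lt _ lL) (tU _ uU); apply: cC.
Qed.

(** * Helly's theorem and nearest points *)

(** Only points of positive weight have to lie in [C], so both sides of a Radon partition can be
    summed over the same index set. *)
Lemma convex_sum (R : realType) (d : nat) (C : set 'rV[R]_d) (K : eqType) (s : seq K)
    (a : K -> 'rV[R]_d) (l : K -> R) :
  convex_set_Rd C -> (forall k, 0 <= l k) -> (forall k, 0 < l k -> C (a k)) ->
  0 < \sum_(k <- s) l k -> C ((\sum_(k <- s) l k)^-1 *: \sum_(k <- s) l k *: a k).
Proof.
move=> cC l0 lC; elim: s => [|x s IH]; first by rewrite big_nil ltxx.
rewrite !big_cons; set S := \sum_(k <- s) l k; set A := \sum_(k <- s) _ => pos.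
have S0 : 0 <= S by apply: sumr_ge0.
have := S0; rewrite le_eqVlt => /predU1P[eS|S_gt0].
  have -> : A = 0.
    rewrite /A; have /allP h : all (fun k => xpredT k ==> (l k == 0)) s.
      by rewrite -psumr_eq0 // -/S -eS.
    by rewrite big_seq big1 // => k /h/= /eqP ->; rewrite scale0r.
  rewrite -eS !addr0 in pos *; rewrite scalerA mulVf ?gt_eqF // scale1r; exact: lC.
have := l0 x; rewrite le_eqVlt => /predU1P[<-|lx]; first by rewrite scale0r !add0r; exact: IH.
have -> : (l x + S)^-1 *: (l x *: a x + A) =
    (l x / (l x + S)) *: a x + (1 - l x / (l x + S)) *: (S^-1 *: A).
  rewrite scalerDr !scalerA; congr (_ *: _ + _ *: _); first by rewrite mulrC.
  by field; rewrite !gt_eqF.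
apply: cC; [exact: lC|exact: IH| |].
  by rewrite divr_ge0 // ltW.
by rewrite ler_pdivrMr // mul1r lerDl.
Qed.

(* Radon partition: the barycentre of the points with positive coefficient is also that of the points
   with negative coefficient, and each H j contains all the points of one of the two sides. *)
Lemma helly_point (R : realType) (d : nat) (K : finType) (a : K -> 'rV[R]_d) (c : K -> R)
    (W : set 'rV[R]_d) (H : K -> set 'rV[R]_d) :
  (exists k, c k != 0) -> \sum_k c k = 0 -> \sum_k c k *: a k = 0 ->
  convex_set_Rd W -> (forall j, convex_set_Rd (H j)) -> (forall k, W (a k)) ->
  (forall j k, j != k -> H j (a k)) -> exists z, W z /\ forall j, H j z.
Proof.
move=> [k0 ck0] c0 ca0 cW cH Wa Ha.
pose p k := Num.max (c k) 0; pose q k := Num.max (- c k) 0.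
have pq k : p k = q k + c k.
  by rewrite /p /q; case: (ltrP (c k) 0); case: (ltrP (- c k) 0) => *; lra.
have p0 k : 0 <= p k by rewrite /p le_max lexx orbT.
have q0 k : 0 <= q k by rewrite /q le_max lexx orbT.
have Spq : \sum_k p k = \sum_k q k.
  by under eq_bigr do rewrite pq; rewrite big_split /= c0 addr0.
have Apq : \sum_k p k *: a k = \sum_k q k *: a k.
  by under eq_bigr do rewrite pq scalerDl; rewrite big_split /= ca0 addr0.
have S0 : 0 < \sum_k p k.
  rewrite lt_neqAle sumr_ge0 ?andbT //.
  apply/eqP => /esym e; have := e; rewrite Spq => e'.
  have /eqP := ck0; apply.
  have hp : p k0 = 0 by apply: (psumr_eq0P _ e).
  have hq : q k0 = 0 by apply: (psumr_eq0P _ e').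
  by have := pq k0; rewrite hp hq add0r.
exists ((\sum_k p k)^-1 *: \sum_k p k *: a k); split; first exact: convex_sum.
move=> j; have [cj|cj] := ltrP 0 (c j).
  rewrite Apq Spq; apply: convex_sum => //; last by rewrite -Spq.
  move=> k; rewrite /q lt_max ltxx orbF => ck; apply: Ha.
  by apply: contraTneq ck => <-; rewrite -leNgt oppr_le0 ltW.
apply: convex_sum => // k; rewrite /p lt_max ltxx orbF => ck; apply: Ha.
by apply: contraTneq ck => <-; rewrite -leNgt.
Qed.

(** Affine dimension expressed by the affine dependence of any m + 2 points, the form that Radon's
    argument consumes. *)
Definition affdim_le (R : realType) (d : nat) (W : set 'rV[R]_d) (m : nat) : Prop :=
  forall (K : finType) (a : K -> 'rV[R]_d), #|K| = m.+2 -> (forall k, W (a k)) ->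
  exists c : K -> R, (exists k, c k != 0) /\ \sum_k c k = 0 /\ \sum_k c k *: a k = 0.

Lemma row_dependence (R : realType) (K : finType) (m : nat) (A : K -> 'I_m -> R) :
  (m < #|K|)%N ->
  exists c : K -> R, (exists k, c k != 0) /\ forall j, \sum_k c k * A k j = 0.
Proof.
move=> hm; pose M := \matrix_(k < #|K|, j < m) A (enum_val k) j.
have : kermx M != 0.
  rewrite kermx_eq0 /row_free; apply: contraTneq hm => <-.
  by rewrite -leqNgt rank_leq_col.
move=> /rowV0Pn[u /sub_kermxP uM u0]; exists (fun k => u ord0 (enum_rank k)); split.
  have /rV0Pn[k hk] := u0.
  by exists (enum_val k); rewrite enum_valK.
move=> j; rewrite (reindex (@enum_val K predT)) /=; last first.
  by exists enum_rank => k _; [exact: enum_valK|exact: enum_rankK].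
have /rowP/(_ j) := uM; rewrite !mxE => e; rewrite -[RHS]e.
by apply: eq_bigr => k _; rewrite enum_valK !mxE.
Qed.

Lemma affdim_space (R : realType) (d : nat) (W : set 'rV[R]_d) : affdim_le W d.
Proof.
move=> K a hK _.
(* The extra column of ones turns linear dependence into affine dependence. *)
have [|c [c0 hc]] := @row_dependence R K d.+1 (fun k => oapp (a k ord0) 1 \o unlift ord0).
  by rewrite hK.
exists c; split=> //; split.
  by rewrite -[RHS](hc ord0); apply: eq_bigr => k _; rewrite /= unlift_none mulr1.
apply/rowP => j; have := hc (lift ord0 j); rewrite /= liftK /= => e.
rewrite summxE mxE -[RHS]e. by apply: eq_bigr => k _; rewrite mxE.
Qed.

Lemma affdim_slice (R : realType) (d : nat) (W : set 'rV[R]_d.+1) (i : 'I_d.+1) (t : R) :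
  affdim_le (W `&` [set x | x ord0 i = t]) d.
Proof.
move=> K a hK ha.
(* Column [i] is constant on the slice, so the column of ones can take its place and one dimension
   is gained. *)
have [|c [c0 hc]] := @row_dependence R K d.+1 (fun k j => if j == i then 1 else a k ord0 j).
  by rewrite hK.
have c1 : \sum_k c k = 0.
  by rewrite -[RHS](hc i); apply: eq_bigr => k _; rewrite eqxx mulr1.
exists c; split=> //; split=> //.
apply/rowP => j; rewrite summxE mxE; have := hc j; case: eqP => [-> _|_ e].
  under eq_bigr => k _ do rewrite mxE (proj2 (ha k)).
  by rewrite -big_distrl /= c1 mul0r.
by rewrite -[RHS]e; apply: eq_bigr => k _; rewrite mxE.
Qed.

Definition q2 (R : realType) (d : nat) (x : 'rV[R]_d) : R := \sum_j x ord0 j ^+ 2.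

(** Strict convexity of the squared norm in exact form; it yields unique nearest points and convex
    balls. *)
Lemma q2_midpoint (R : realType) (d : nat) (x y : 'rV[R]_d) (t : R) :
  q2 (t *: x + (1 - t) *: y) = t * q2 x + (1 - t) * q2 y - t * (1 - t) * q2 (x - y).
Proof.
rewrite /q2 !big_distrr /= -big_split /= -sumrB; apply: eq_bigr => j _.
by rewrite !mxE; ring.
Qed.

Lemma q2_ge0 (R : realType) (d : nat) (x : 'rV[R]_d) : 0 <= q2 x.
Proof. by apply: sumr_ge0 => j _; exact: sqr_ge0. Qed.

Lemma q2_eq0 (R : realType) (d : nat) (x : 'rV[R]_d) : q2 x = 0 -> x = 0.
Proof.
move=> h; apply/rowP => j; rewrite mxE.
have /eqP := psumr_eq0P (fun j _ => sqr_ge0 (x ord0 j)) h (i := j) erefl.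
by rewrite sqrf_eq0 => /eqP.
Qed.

Definition is_nearest (R : realType) (d : nat) (K : set 'rV[R]_d) (x : 'rV[R]_d) : Prop :=
  K x /\ forall y, K y -> q2 x <= q2 y.

(** A total function, so that points can be named by index sets alone; its value is 0 if no nearest
    point exists. *)
Definition nearest (R : realType) (d : nat) (K : set 'rV[R]_d) : 'rV[R]_d :=
  xget 0 [set x | is_nearest K x].

Lemma nearestP (R : realType) (d : nat) (K : set 'rV[R]_d) :
  compact K -> K !=set0 -> is_nearest K (nearest K).
Proof.
move=> cK K0; have [|x /set_mem Kx hx] := @EVT_min_rV R d (@q2 R d) K K0 cK.
  apply: continuous_subspaceT => x; rewrite /q2.
  have -> : (fun y : 'rV[R]_d => \sum_j y ord0 j ^+ 2) =
            \sum_(j < d) (fun y : 'rV[R]_d => y ord0 j * y ord0 j).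
    by apply/funext => y; rewrite fct_sumE; apply: eq_bigr => j _; rewrite expr2.
  elim/big_ind: _ => [|f g cf cg|j _]; first exact: (@cst_continuous _ _ (0 : R)).
    exact: (continuousD cf cg).
  by apply: continuousM; exact: coord_continuous.
by rewrite /nearest; case: xgetP => [y ->//|/(_ x)[]]; split=> // y Ky; apply: hx; rewrite inE.
Qed.

Lemma nearest_unique (R : realType) (d : nat) (K : set 'rV[R]_d) (x y : 'rV[R]_d) :
  convex_set_Rd K -> is_nearest K x -> K y -> q2 y <= q2 x -> y = x.
Proof.
move=> cK [Kx hx] Ky yx; apply/eqP; rewrite -subr_eq0; apply/eqP/q2_eq0.
have := hx _ (cK y x Ky Kx 2^-1 ltac:(lra) ltac:(lra)).
rewrite q2_midpoint; have := q2_ge0 (y - x); have := hx _ Ky; lra.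
Qed.

(** The ambient set [W] keeps the intersection compact even for empty [T], and can be replaced by a
    slice. *)
Definition cap (R : realType) (d : nat) (J : finType) (W : set 'rV[R]_d)
    (F : J -> set 'rV[R]_d) (T : {set J}) : set 'rV[R]_d :=
  [set x | W x /\ forall j, j \in T -> F j x].

Section Nearest.
Context (R : realType) (d : nat) (J : finType) (W : set 'rV[R]_d) (F : J -> set 'rV[R]_d).
Hypotheses (cvW : convex_set_Rd W) (cvF : forall j, convex_set_Rd (F j))
  (cpW : compact W) (cpF : forall j, compact (F j)).

Lemma convex_cap T : convex_set_Rd (cap W F T).
Proof.
move=> x y [Wx Fx] [Wy Fy] t t0 t1; split; first exact: cvW.
by move=> j jT; apply: cvF; [exact: Fx|exact: Fy| |].
Qed.

Lemma compact_cap T : compact (cap W F T).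
Proof.
have -> : cap W F T = W `&` \bigcap_(j in [set j | j \in T]) F j.
  by apply/seteqP; split=> x [Wx Fx]; split=> // j; exact: Fx.
apply: compact_closedI => //; apply: closed_bigI => j _.
by apply: compact_closed => //; exact: norm_hausdorff.
Qed.

Lemma cap_nearestP T : cap W F T !=set0 -> is_nearest (cap W F T) (nearest (cap W F T)).
Proof. exact/nearestP/compact_cap. Qed.

(* Helly's theorem for the sets of T and the open ball reaching the nearest point. *)
Lemma nearest_drop (m : nat) (T : {set J}) : affdim_le W m -> #|T| = m.+1 ->
  cap W F T !=set0 ->
  exists2 e, e \in T & nearest (cap W F (T :\ e)%SET) = nearest (cap W F T).
Proof.
move=> aW cT T0; have [[Wp Fp] pmin] := cap_nearestP T0.
set p := nearest (cap W F T) in Wp Fp pmin *.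
apply: contrapT => /forall2NP h.
have {}h (e : {j | j \in T}) : exists q, cap W F (T :\ val e)%SET q /\ q2 q < q2 p.
  apply: contrapT => /forallNP h'; have [//|] := h (val e); first by case: (valP e).
  have pc : cap W F (T :\ val e)%SET p.
    by split=> // j; rewrite !inE => /andP[_ /Fp].
  apply; apply/esym/(@nearest_unique _ _ (cap W F (T :\ val e)%SET)) => //.
  - exact: convex_cap.
  - by apply: cap_nearestP; exists p.
  have [ac _] := cap_nearestP (ex_intro _ p pc).
  by rewrite leNgt; apply/negP => lt; apply: (h' (nearest (cap W F (T :\ val e)%SET))).
have {h}[q hq] := choice h.
(* Radon data: m + 2 points and as many sets, where [a k] lies in every set except possibly
   [H k]. *)
pose a (k : option {j | j \in T}) := if k is Some e then q e else p.
pose H (k : option {j | j \in T}) : set 'rV[R]_d :=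
  if k is Some e then F (val e) else [set x | q2 x < q2 p].
have Wa k : W (a k) by case: k => [e|] //=; have [[]] := hq e.
have [|c [c0 [c1 ca]]] := aW _ a _ Wa; first by rewrite card_option card_sig cT.
have [||z [Wz Hz]] := helly_point c0 c1 ca cvW _ Wa (H := H).
- case=> [e|] /=; first exact: cvF.
  move=> x y /= hx hy t t0 t1; rewrite q2_midpoint.
  have := q2_ge0 (x - y); have : 0 <= t * (1 - t) by rewrite mulr_ge0 //; lra.
  move=> h1 h2; have := mulr_ge0 h1 h2.
  have hx' : 0 < q2 p - q2 x by rewrite subr_gt0.
  have hy' : 0 < q2 p - q2 y by rewrite subr_gt0.
  have t1' : 0 <= 1 - t by lra.
  have := mulr_ge0 t1' (ltW hy'); have [t0'|t0'] := ltrP 0 t.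
    have := mulr_gt0 t0' hx'; lra.
  have -> : t = 0 by lra.
  lra.
- case=> [j|] [k|] //=; last by have [] := hq k.
    move=> jk; have [[_ h] _] := hq k; apply: h; rewrite !inE (valP j) andbT.
    by apply: contra jk => /eqP/val_inj ->.
  by move=> _; apply: Fp; exact: (valP j).
have := pmin z; rewrite leNgt => /(_ _)/negP; apply; last exact: (Hz None).
by split=> // j jT; apply: (Hz (Some (Sub j jT))).
Qed.

End Nearest.

(** * Pairs from homogeneous configurations *)

Lemma convex_level (R : realType) (n : nat) (G : set 'rV[R]_n) (x z : 'rV[R]_n) (i : 'I_n)
    (s : bool) (t : R) : convex_set_Rd G -> G x -> G z ->
  0 <= (-1) ^+ s * (t - x ord0 i) -> 0 <= (-1) ^+ s * (z ord0 i - t) ->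
  exists2 w, G w & w ord0 i = t.
Proof.
move=> cG Gx Gz; case: s => /=; rewrite ?expr1 ?expr0 => h1 h2.
  have [||r0 [r1 rt]] := @segment_level R (z ord0 i) (x ord0 i) t; [lra|lra|].
  by eexists; [exact: (cG _ _ Gz Gx _ r0 r1)|rewrite !mxE].
have [||r0 [r1 rt]] := @segment_level R (x ord0 i) (z ord0 i) t; [lra|lra|].
by eexists; [exact: (cG _ _ Gx Gz _ r0 r1)|rewrite !mxE].
Qed.

Section Config.
Context (R : realType) (d : nat) (J : finType) (F : J -> set 'rV[R]_d).
Hypotheses (cvF : forall j, convex_set_Rd (F j)) (cpF : forall j, compact (F j)).

Definition rainbow (K : finType) (A : K -> bool -> J) (b : {ffun K -> bool}) : {set J} :=
  [set A k (b k) | k : K]%SET.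

Definition separated (K : Type) (A : K -> bool -> J) : Prop :=
  forall k b k' b', A k b = A k' b' -> k = k' /\ b = b'.

Definition recolor (K : finType) (b : {ffun K -> bool}) (k : K) (v : bool) : {ffun K -> bool} :=
  [ffun k' => if k' == k then v else b k'].

Section Rainbow.
Context (K : finType) (A : K -> bool -> J).
Hypothesis sA : separated A.

Lemma card_rainbow b : #|rainbow A b| = #|K|.
Proof. by rewrite card_imset // => k k' /sA[]. Qed.

Lemma rainbowP (b : {ffun K -> bool}) j : reflect (exists k, j = A k (b k)) (j \in rainbow A b).
Proof. by apply: (iffP imsetP) => [[k _ ->]|[k ->]]; exists k. Qed.

Lemma rainbow_recolor (b : {ffun K -> bool}) k v :
  (rainbow A (recolor b k v) :\ A k v = rainbow A b :\ A k (b k))%SET.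
Proof.
apply/setP => j; rewrite !inE; apply/andP/andP => -[jk /rainbowP[k' e]];
  move: jk; rewrite e ?ffunE; case: (eqVneq k' k) => [->|kk] jk.
- by rewrite eqxx in jk.
- split; last by apply/rainbowP; exists k'.
  by apply: contra kk => /eqP/sA[->].
- by rewrite eqxx in jk.
split; first by apply: contra kk => /eqP/sA[->].
by apply/rainbowP; exists k'; rewrite ffunE (negbTE kk).
Qed.

Lemma notin_rainbowD (b : {ffun K -> bool}) k v : A k v \notin (rainbow A b :\ A k (b k))%SET.
Proof.
rewrite !inE; apply/negP => /andP[h /rainbowP[k' /sA[e1 e2]]].
by move: h; rewrite e2 e1 eqxx.
Qed.

Lemma in_rainbow (b : {ffun K -> bool}) k : A k (b k) \in rainbow A b.
Proof. by apply/rainbowP; exists k. Qed.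

(* Lovász's colourful Helly argument: drop one class so that the nearest point is as far as possible. *)
Lemma colorful_helly (W : set 'rV[R]_d) (m : nat) :
  convex_set_Rd W -> compact W -> affdim_le W m -> #|K| = m.+1 ->
  (forall b, cap W F (rainbow A b) !=set0) ->
  exists k (D : {set J}), (forall v, A k v \notin D) /\ cap W F D !=set0 /\
    forall v, F (A k v) (nearest (cap W F D)).
Proof.
move=> cvW cpW aW cK H.
have /card_gt0P[k0 _] : (0 < #|K|)%N by rewrite cK.
pose E (p : {ffun K -> bool} * K) := (rainbow A p.1 :\ A p.2 (p.1 p.2))%SET.
pose f p := q2 (nearest (cap W F (E p))).
case: (@arg_maxP _ _ _ ([ffun _ => false], k0) predT f) => // -[b k] _ hmax.
have sub b' (T : {set J}) : T \subset rainbow A b' -> cap W F (rainbow A b') `<=` cap W F T.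
  by move=> /fintype.subsetP sT x [Wx h]; split=> // j /sT/h.
have E0 p : cap W F (E p) !=set0.
  by have [x hx] := H p.1; exists x; apply: sub hx; exact: subD1set.
exists k, (E (b, k)); split; first by move=> v; exact: notin_rainbowD.
split=> // v; pose b' := recolor b k v.
have eE : E (b, k) = (rainbow A b' :\ A k v)%SET by rewrite rainbow_recolor.
have [|e /rainbowP[k' ->] he] := nearest_drop cvW cvF cpW cpF aW _ (H b').
  by rewrite card_rainbow cK.
have [[Wy Fy] _] := cap_nearestP cpW cpF (H b').
set y := nearest (cap W F (rainbow A b')) in he Wy Fy.
have nE := cap_nearestP cpW cpF (E0 (b, k)).
(* [y] is the nearest point for [E (b', k')], so by maximality it is no farther than that for
   [E (b, k)]; it also lies in the latter intersection, and uniqueness identifies the two. *)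
suff <- : y = nearest (cap W F (E (b, k))).
  by apply: Fy; have := in_rainbow b' k; rewrite ffunE eqxx.
apply: nearest_unique nE _ _; first exact: convex_cap.
  by rewrite eE; apply: (sub b'); [exact: subD1set|split].
by rewrite -he; exact: (hmax (b', k')).
Qed.

End Rainbow.
End Config.

(* A point recipe (D, o) names the point of the intersection of the sets in D nearest to the origin, within
   W, or, when o = Some (i, s, j, D'), within the slice of W at coordinate i whose level is at signed
   distance (j + 1) * v from the nearest point of the intersection of the sets in D'. *)
Definition recipe (J : finType) (n : nat) : finType :=
  ({set J} * option ('I_n.+1 * bool * 'I_n.+2 * {set J}))%type.

Section Recipe.
Context (R : realType) (n : nat) (J : finType) (W : set 'rV[R]_n.+1) (v : R).

Definition recipe_domain (F : J -> set 'rV[R]_n.+1) (r : recipe J n) : set 'rV[R]_n.+1 :=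
  if r.2 is Some (i, s, j, D) then
    W `&` [set x | x ord0 i = nearest (cap W F D) ord0 i + (-1) ^+ s * (j.+1%:R * v)]
  else W.

Definition recipe_point (F : J -> set 'rV[R]_n.+1) (r : recipe J n) : 'rV[R]_n.+1 :=
  nearest (cap (recipe_domain F r) F r.1).

Definition recipe_avoids (f : J) (r : recipe J n) : bool :=
  (f \notin r.1) && (if r.2 is Some (_, _, _, D) then f \notin D else true).

Lemma eq_cap (W' : set 'rV[R]_n.+1) (F F' : J -> set 'rV[R]_n.+1) (f : J) (T : {set J}) :
  (forall j, j != f -> F j = F' j) -> f \notin T -> cap W' F T = cap W' F' T.
Proof.
move=> h fT; apply/seteqP; split=> x [Wx Fx]; split=> // j jT.
  by rewrite -h; [exact: Fx|apply: contraNneq fT => <-].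
by rewrite h; [exact: Fx|apply: contraNneq fT => <-].
Qed.

(** No set at index [f] enters the construction of the point; hence one entry of a tuple may vary in
    the averaging while the point stays. *)
Lemma eq_recipe_point (F F' : J -> set 'rV[R]_n.+1) (f : J) (r : recipe J n) :
  (forall j, j != f -> F j = F' j) -> recipe_avoids f r ->
  recipe_point F r = recipe_point F' r.
Proof.
rewrite /recipe_point /recipe_domain /recipe_avoids => h.
case: r => D [[[[i s] j] D']|] /= /andP[fD fD'].
  by rewrite (eq_cap W h fD') (eq_cap _ h fD).
by rewrite (eq_cap _ h fD).
Qed.

Lemma compact_slice (i : 'I_n.+1) (t : R) : compact W -> compact (W `&` [set x | x ord0 i = t]).
Proof.
move=> cW; apply: compact_closedI => //.
rewrite -[X in closed X]/((fun x : 'rV[R]_n.+1 => x ord0 i) @^-1` [set t]).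
by apply: closed_comp => [x _|]; [exact: coord_continuous|exact: closed_eq].
Qed.

Lemma convex_slice (i : 'I_n.+1) (t : R) :
  convex_set_Rd W -> convex_set_Rd (W `&` [set x | x ord0 i = t]).
Proof.
move=> cW x y [Wx /= xt] [Wy /= yt] l l0 l1; split; first exact: cW.
by rewrite /= !mxE xt yt; ring.
Qed.

Context (F : J -> set 'rV[R]_n.+1).
Hypotheses (cvW : convex_set_Rd W) (cvF : forall j, convex_set_Rd (F j))
  (cpW : compact W) (cpF : forall j, compact (F j)).

(* If the nearest points of the rainbow intersections without class e spread by v in the direction i,
   both members of class e contain two of them far apart. Otherwise all rainbow intersections cross
   n + 2 common levels, and by the colourful Helly theorem in each level one of the n + 1 other
   classes has a common point there; some class serves twice. *)
Lemma spread_pair (i : 'I_n.+1) (s : bool) (A : 'I_n.+2 -> bool -> J) (e : 'I_n.+2) :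
  0 < v -> separated A ->
  (forall b, exists z, cap W F (rainbow A b) z /\
     n.+3%:R * v <= (-1) ^+ s * (z ord0 i - nearest (cap W F (rainbow A b)) ord0 i)) ->
  (forall b, nearest (cap W F (rainbow A b :\ A e (b e))%SET) = nearest (cap W F (rainbow A b))) ->
  exists f (r1 r2 : recipe J n), recipe_avoids f r1 /\ recipe_avoids f r2 /\
    F f (recipe_point F r1) /\ F f (recipe_point F r2) /\
    v <= `|recipe_point F r1 ord0 i - recipe_point F r2 ord0 i|.
Proof.
move=> v0 sA H1 H2.
pose D b := (rainbow A b :\ A e (b e))%SET.
pose x b := nearest (cap W F (D b)).
have T0 b : cap W F (rainbow A b) !=set0 by have [z [hz _]] := H1 b; exists z.
(* Recolouring class [e] leaves [x b] unchanged, so both members of that class contain it. *)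
have xF b u : F (A e u) (x b).
  rewrite /x /D -(rainbow_recolor sA b e u).
  have := H2 (recolor b e u); rewrite {1}ffunE eqxx => ->.
  have [[_ h] _] := cap_nearestP cpW cpF (T0 (recolor b e u)).
  by apply: h; have := in_rainbow A (recolor b e u) e; rewrite ffunE eqxx.
have avoid_e b : recipe_avoids (A e true) ((D b, None) : recipe J n).
  by rewrite /recipe_avoids andbT; exact: notin_rainbowD.
have [[b [b' bb]]|near_x] := pselect (exists b b', v <= `|x b ord0 i - x b' ord0 i|).
  exists (A e true), (D b, None), (D b', None); split; first exact: avoid_e.
  split; first exact: avoid_e.
  by split; [exact: xF|split; [exact: xF|exact: bb]].
have {}near_x b b' : `|x b ord0 i - x b' ord0 i| < v.
  by rewrite ltNge; apply/negP => h; apply: near_x; exists b, b'.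
pose b0 : {ffun 'I_n.+2 -> bool} := [ffun _ => false].
(* The levels lie at distances v, ..., (n + 2)v from [x b0]; the width (n + 3)v leaves a margin v at
   both ends for the other [x b]. *)
pose lev (j : 'I_n.+2) := x b0 ord0 i + (-1) ^+ s * (j.+1%:R * v).
have lev0 (j : 'I_n.+2) b : exists2 w, cap W F (rainbow A b) w & w ord0 i = lev j.
  have [z [hz zi]] := H1 b; have [hx _] := cap_nearestP cpW cpF (T0 b).
  rewrite -(H2 b) -/(D b) -/(x b) in hx zi.
  have := near_x b b0; rewrite ltr_norml => /andP[n1 n2].
  have s2 : (-1) ^+ s * (-1) ^+ s = 1 :> R by case: (s); rewrite ?expr0 ?expr1; lra.
  have j1 : v <= j.+1%:R * v by rewrite ler_peMl ?ler1n // ltW.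
  have j2 : j.+1%:R * v + v <= n.+3%:R * v.
    by rewrite -[X in _ + X]mul1r -mulrDl ler_wpM2r ?(ltW v0) // natr1 ler_nat ltnS ltn_ord.
  apply: (@convex_level _ _ _ (x b) z i s) => //; first exact: convex_cap.
    rewrite /lev; case: (s) s2 => /=; rewrite ?expr0 ?expr1 => _; lra.
  move: zi; rewrite /lev; case: (s) s2 => /=; rewrite ?expr0 ?expr1 => _; lra.
pose K : finType := {k | k != e}.
have cK : #|K| = n.+1 by rewrite card_sig cardC1 card_ord.
pose AK (k : K) := A (val k).
have sAK : separated AK by move=> k b k' b' /sA[/val_inj -> ->].
pose Wj j := W `&` [set y | y ord0 i = lev j].
have class j : exists kD : K * {set J}, (forall u, AK kD.1 u \notin kD.2) /\
    cap (Wj j) F kD.2 !=set0 /\ forall u, F (AK kD.1 u) (nearest (cap (Wj j) F kD.2)).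
  have [|||||k [E hE]] := @colorful_helly R n.+1 J F cvF cpF K AK sAK (Wj j) n.
  - exact: convex_slice.
  - exact: compact_slice.
  - exact: affdim_slice.
  - exact: cK.
  - move=> b; pose b' : {ffun 'I_n.+2 -> bool} := [ffun k => if insub k is Some k' then b k' else false].
    have [w [Ww Fw] wl] := lev0 j b'; exists w; split=> // u /rainbowP[k ->]; apply: Fw.
    by apply/rainbowP; exists (val k); rewrite ffunE valK.
  by exists (k, E).
have [kD hkD] := choice class.
have [j [j' [jj ek]]] : exists j j', j != j' /\ (kD j).1 = (kD j').1.
  apply: contrapT => h; have inj : injective (fun j => (kD j).1).
    by move=> j j' ejj; apply: contrapT => /eqP ne; apply: h; exists j, j'.
  by have := leq_card _ inj; rewrite cK card_ord ltnn.
pose r j : recipe J n := ((kD j).2, Some (i, s, j, D b0)).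
have rp j0 : recipe_point F (r j0) = nearest (cap (Wj j0) F (kD j0).2) by [].
have rl j0 : recipe_point F (r j0) ord0 i = lev j0.
  have [_ [h _]] := hkD j0; rewrite rp.
  by have [[[]]] := cap_nearestP (compact_slice cpW (i := i) (t := lev j0)) cpF h.
exists (AK (kD j).1 true), (r j), (r j').
(* [D b0] uses only members [false], so the member [true] of the repeated class is avoided by the
   whole recipe. *)
have avoid_b0 k : A k true \notin D b0.
  by rewrite !inE negb_and; apply/orP; right; apply/rainbowP => -[k' /sA[_]]; rewrite ffunE.
have [a1 [_ f1]] := hkD j; have [a2 [_ f2]] := hkD j'.
rewrite !rl; split; first by rewrite /recipe_avoids /= a1 avoid_b0.
split; first by rewrite /recipe_avoids /= ek a2 avoid_b0.
split; first exact: f1.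
split; first by rewrite ek; exact: f2.
have -> : lev j - lev j' = (-1) ^+ s * ((j%:R - j'%:R) * v) by rewrite /lev -!natr1; ring.
rewrite !normrM normrX normrN1 expr1n mul1r (gtr0_norm v0) ler_peMl ?(ltW v0) //.
rewrite -[j%:R]/(j%:Z%:~R) -[j'%:R]/(j'%:Z%:~R) -intrB -intr_norm ler1z.
by rewrite -gtz0_ge1 normr_gt0 subr_eq0.
Qed.

End Recipe.

(** * Homogeneous classes by Ramsey's theorem *)

Lemma subseq_nth (T : eqType) (x0 : T) (u : seq T) (l : seq nat) :
  sorted ltn l -> {in l, forall k, (k < size u)%N} -> subseq (map (nth x0 u) l) u.
Proof.
move=> sl hl; rewrite -[X in subseq _ X](mkseq_nth x0 u) /mkseq; apply: map_subseq.
have -> : l = [seq k <- iota 0 (size u) | k \in l]; last exact: filter_subseq.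
apply: (irr_sorted_eq ltn_trans ltnn) => //.
  by apply: sorted_filter; [exact: ltn_trans|exact: iota_ltn_sorted].
move=> k; rewrite mem_filter mem_iota add0n /=.
by case kl: (k \in l); rewrite // hl.
Qed.

Definition wide (R : realType) (n : nat) (w : R) (C : set 'rV[R]_n) : Prop :=
  exists x y i, C x /\ C y /\ w <= `|x ord0 i - y ord0 i|.

(** Two points 2w apart in coordinate [i] cannot both be closer than [w] to [p] in it. *)
Lemma wide_sign (R : realType) (n : nat) (w : R) (C : set 'rV[R]_n) (p : 'rV[R]_n) :
  wide (2 * w) C -> exists i (s : bool) z, C z /\ w <= (-1) ^+ s * (z ord0 i - p ord0 i).
Proof.
move=> [x [y [i [Cx [Cy h]]]]]; exists i.
have [h1|h1] := lerP w (x ord0 i - p ord0 i).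
  by exists false, x; rewrite expr0 mul1r.
have [h2|h2] := lerP w (p ord0 i - x ord0 i).
  by exists true, x; rewrite expr1 mulN1r opprB.
have [h3|h3] := lerP w (y ord0 i - p ord0 i).
  by exists false, y; rewrite expr0 mul1r.
exists true, y; rewrite expr1 mulN1r opprB; split=> //.
by move: h; rewrite ler_normr => /orP[]; lra.
Qed.

Lemma homogeneous_pair (R : realType) (n q : nat) : exists N : nat,
  forall (W : set 'rV[R]_n.+1) (G : 'I_N -> set 'rV[R]_n.+1) (v : R), 0 < v ->
  convex_set_Rd W -> compact W ->
  (forall k, convex_set_Rd (G k)) -> (forall k, compact (G k)) ->
  (forall u, subseq u (enum 'I_N) -> size u = q -> exists t, subseq t u /\ size t = n.+2 /\
     wide (2 * (n.+3%:R * v)) (cap W G [set x in t]%SET)) ->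
  exists f i (r1 r2 : recipe 'I_N n), recipe_avoids f r1 /\ recipe_avoids f r2 /\
    G f (recipe_point W v G r1) /\ G f (recipe_point W v G r2) /\
    v <= `|recipe_point W v G r1 ord0 i - recipe_point W v G r2 ord0 i|.
Proof.
(* A colour records the direction, the side and the position of the droppable set; [None] marks
   narrow intersections. The first [q] elements refute [None], and 2(n + 2) elements supply the
   classes. *)
have [N hN] := ramsey (option ('I_n.+1 * bool * 'I_n.+2)) n.+2 (q + 2 * n.+2).
exists N => W G v v0 cvW cpW cvG cpG hq.
pose T (t : seq 'I_N) := cap W G [set x in t]%SET.
pose Col (c : option ('I_n.+1 * bool * 'I_n.+2)) (t : seq 'I_N) :=
  if c is Some (i, s, e) then
    (exists z, T t z /\ n.+3%:R * v <= (-1) ^+ s * (z ord0 i - nearest (T t) ord0 i)) /\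
    (forall x, x \in t -> index x t = e ->
       nearest (cap W G ([set x in t] :\ x)%SET) = nearest (T t))
  else ~ wide (2 * (n.+3%:R * v)) (T t).
have [||c [u [us [su hu]]]] := hN _ (enum 'I_N) Col; first by rewrite size_enum_ord.
  move=> t tN st; have ut : uniq t := subseq_uniq tN (enum_uniq _).
  have [hw|hw] := pselect (wide (2 * (n.+3%:R * v)) (T t)); last by exists None.
  have [i [s [z [Tz zi]]]] := wide_sign (nearest (T t)) hw.
  have [||e et he] := nearest_drop cvW cvG cpW cpG (@affdim_space _ _ W) (T := [set x in t]%SET).
  - by rewrite cardsE -st; apply/card_uniqP.
  - by exists z.
  rewrite inE in et; have ie : (index e t < n.+2)%N by rewrite -st index_mem.
  exists (Some (i, s, Ordinal ie)); split; first by exists z.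
  move=> x xt /= ex; suff -> : x = e by [].
  by rewrite -(nth_index e xt) ex nth_index.
have uu : uniq u := subseq_uniq us (enum_uniq _).
case: c hu => [[[i s] e]|] hu; last first.
  have [||t [tu [st wt]]] := hq (take q u).
  - exact: subseq_trans (take_subseq _ _) us.
  - by rewrite size_takel // su leq_addr.
  by case: (hu t (subseq_trans tu (take_subseq _ _)) st).
have [x0 _] : exists x0 : 'I_N, true by case: u su {us uu hu} => [/= ?|x0 u _]; [lia|exists x0].
(* Class [k] occupies the adjacent positions 2k and 2k + 1, so every rainbow choice is a subsequence
   whose entry at index [k] comes from class [k]. *)
pose pos (k : 'I_n.+2) (b : bool) := (2 * k + b)%N.
have pos_lt k b : (pos k b < size u)%N by rewrite su /pos; have := ltn_ord k; case: b; lia.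
pose A k b := nth x0 u (pos k b).
have sA : separated A.
  move=> k b k' b' /eqP; rewrite /A nth_uniq // /pos => /eqP e'.
  by split; [apply: val_inj => /=|]; case: b b' e' => -[] //=; lia.
pose tb (b : {ffun 'I_n.+2 -> bool}) := [seq A k (b k) | k <- enum 'I_n.+2].
have tb_sub b : subseq (tb b) u.
  rewrite /tb (map_comp (nth x0 u) (fun k => pos k (b k))).
  apply: subseq_nth; last by move=> _ /mapP[k _ ->].
  rewrite sorted_map; apply: (@sub_sorted _ (relpre val ltn)) => [k k' /=|].
    by rewrite /pos; case: (b k); case: (b k'); lia.
  by rewrite -sorted_map val_enum_ord iota_ltn_sorted.
have tb_set b : [set x in tb b]%SET = rainbow A b.
  apply/setP => j; rewrite inE; apply/mapP/rainbowP => -[k]; first by move=> _ ->; exists k.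
  by move=> ->; exists k; rewrite // mem_enum.
have tb_col b : Col (Some (i, s, e)) (tb b).
  by apply: hu; rewrite ?tb_sub // size_map size_enum_ord.
have [||f [r1 [r2 h]]] := spread_pair (i := i) (s := s) (e := e) cvW cvG cpW cpG v0 sA.
- by move=> b; have [] := tb_col b; rewrite /T tb_set.
- move=> b; have [_ h] := tb_col b; rewrite -tb_set; apply: h.
    by apply: map_f; rewrite mem_enum.
  by rewrite /tb (@index_map _ _ (fun k => A k (b k))) ?index_enum_ord // => k k' /sA[].
by exists f, i, r1, r2.
Qed.

(** * Heavy pairs for integer weights, realised by copies *)

Lemma sum_tagged (I : finType) (w : I -> nat) (P : pred I) :
  #|[pred j : {i : I & 'I_(w i)} | P (tag j)]| = (\sum_(i | P i) w i)%N.
Proof.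
rewrite -sum1_card; under [RHS]eq_bigr => i _ do rewrite -[w i]card_ord -sum1_card.
rewrite sig_big_dep /=; apply: eq_bigl => j /=; by rewrite andbT.
Qed.

Lemma weighted_pair (R : realType) (n q : nat) : exists Q : nat, (0 < Q)%N /\
  forall (I : finType) (W : set 'rV[R]_n.+1) (F : I -> set 'rV[R]_n.+1) (v : R), 0 < v ->
  convex_set_Rd W -> compact W ->
  (forall k, convex_set_Rd (F k)) -> (forall k, compact (F k)) ->
  (forall u : seq I, size u = q -> exists t, subseq t u /\ size t = n.+2 /\
     wide (2 * (n.+3%:R * v)) (cap W F [set x in t]%SET)) ->
  forall w : I -> nat, (0 < \sum_i w i)%N -> exists (x y : 'rV[R]_n.+1) i, v <= `|x ord0 i - y ord0 i| /\
    (\sum_i w i <= Q * \sum_(i | `[< F i x /\ F i y >]) w i)%N.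
Proof.
have [N hN] := homogeneous_pair R n q.
pose QT : finType := ('I_N * 'I_n.+1 * recipe 'I_N n * recipe 'I_N n)%type.
exists #|QT|.+1; split=> // I W F v v0 cvW cpW cvF cpF hq w w0.
pose J : finType := {i : I & 'I_(w i)}.
pose G (g : {ffun 'I_N -> J}) k := F (tag (g k)).
pose ok (p : QT) (g : {ffun 'I_N -> J}) := let: (f, i, r1, r2) := p in
  `[< recipe_avoids f r1 /\ recipe_avoids f r2 /\
    G g f (recipe_point W v (G g) r1) /\ G g f (recipe_point W v (G g) r2) /\
    v <= `|recipe_point W v (G g) r1 ord0 i - recipe_point W v (G g) r2 ord0 i| >].
have cJ : #|J| = (\sum_i w i)%N by rewrite -(sum_tagged w predT); apply: eq_card.
rewrite -cJ in w0 *.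
(* Every N-tuple of copies has a good pair of recipes; averaging fixes a tuple, a position [f] and
   two recipes that stay good for a positive fraction of the replacements at [f]. *)
have [|[[[f i] r1] r2] [g hg]] := @upd_average _ _ QT (fun p => p.1.1.1) ok w0.
  move=> g; have [|f [i [r1 [r2 h]]]] := hN W (G g) v v0 cvW cpW (fun k => cvF _) (fun k => cpF _).
    move=> u _ su; have [|t [tu [st wt]]] := hq [seq tag (g k) | k <- u]; first by rewrite size_map.
    have [m sm et] := subseqP tu; exists (mask m u); rewrite mask_subseq; split=> //.
    rewrite -map_mask in et; split; first by rewrite -st et size_map.
    move: wt => [x [y [j [[Wx Fx] [[Wy Fy] xy]]]]].
    exists x, y, j; split; [|split] => //; split=> // k; rewrite inE => ku.
      by apply: Fx; rewrite inE et; exact: (map_f (fun k => tag (g k))).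
    by apply: Fy; rewrite inE et; exact: (map_f (fun k => tag (g k))).
  by exists (f, i, r1, r2); apply/asboolP.
rewrite /= in hg; set x := recipe_point W v (G g) r1; set y := recipe_point W v (G g) r2.
have okE j : ok (f, i, r1, r2) (upd g f j) ->
    F (tag j) x /\ F (tag j) y /\ v <= `|x ord0 i - y ord0 i|.
  move=> /asboolP[a1 [a2]].
  have eG k : k != f -> G (upd g f j) k = G g k by move=> /negbTE kf; rewrite /G ffunE kf.
  by rewrite !(eq_recipe_point W v eG) // /G ffunE eqxx.
exists x, y, i; split.
  have : (0 < #|[pred j | ok (f, i, r1, r2) (upd g f j)]|)%N.
    rewrite lt0n; apply/eqP => e; move: hg; rewrite e muln0 leqn0 => /eqP e0.
    by rewrite e0 in w0.
  by move=> /card_gt0P[j /okE[_ []]].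
apply: leq_trans hg _; apply: leq_mul; first exact: leqnSn.
rewrite -sum_tagged; apply: subset_leq_card.
apply/fintype.subsetP => j jok; have [h1 [h2 _]] := okE j jok.
by rewrite unfold_in; apply/asboolP.
Qed.

(** * Compact hulls and diameter *)

Lemma convex_join (R : realType) (d : nat) (C : set 'rV[R]_d) (x : 'rV[R]_d) :
  convex_set_Rd C -> convex_set_Rd [set z | exists t y, [/\ 0 <= t, t <= 1, C y &
    z = t *: x + (1 - t) *: y]].
Proof.
move=> cC _ _ [t [y [t0 t1 Cy ->]]] [t' [y' [t'0 t'1 Cy' ->]]] l l0 l1 /=.
have h1 : 0 <= l * (1 - t) by apply: mulr_ge0; lra.
have h2 : 0 <= (1 - l) * (1 - t') by apply: mulr_ge0; lra.
have h3 : 0 <= l * t by apply: mulr_ge0; lra.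
have h4 : 0 <= (1 - l) * t' by apply: mulr_ge0; lra.
set s := l * t + (1 - l) * t'.
have s1 : 1 - s = l * (1 - t) + (1 - l) * (1 - t') by rewrite /s; ring.
(* In the degenerate case the combination is [x] itself. *)
have [e|e] := eqVneq (1 - s) 0.
  exists 1, y; split=> //; rewrite subrr scale0r addr0 scale1r.
  have e1 : l * (1 - t) = 0 by lra.
  have e2 : (1 - l) * (1 - t') = 0 by lra.
  rewrite !scalerDr !scalerA e1 e2 !scale0r !addr0 -scalerDl -/s.
  by rewrite (_ : s = 1) ?scale1r //; lra.
have s_gt : 0 < 1 - s by rewrite lt_neqAle eq_sym e s1 addr_ge0.
pose r := l * (1 - t) / (1 - s).
exists s, (r *: y + (1 - r) *: y'); split; [by rewrite addr_ge0|lra| |].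
  apply: cC => //; first by rewrite divr_ge0 // ltW.
  by rewrite ler_pdivrMr // mul1r s1 lerDl.
rewrite !scalerDr !scalerA addrACA -scalerDl -/s; congr (_ + (_ *: _ + _ *: _)).
  by rewrite /r; field.
by rewrite /r s1; field; rewrite -s1.
Qed.

Lemma compact_join (R : realType) (d : nat) (C : set 'rV[R]_d) (x : 'rV[R]_d) :
  compact C -> compact [set z | exists t y, [/\ 0 <= t, t <= 1, C y &
    z = t *: x + (1 - t) *: y]].
Proof.
move=> cC.
have -> : [set z | exists t y, [/\ 0 <= t, t <= 1, C y & z = t *: x + (1 - t) *: y]] =
    (fun p : R * 'rV[R]_d => p.1 *: x + (1 - p.1) *: p.2) @` (`[0, 1] `*` C).
  apply/seteqP; split=> z /=.
    by move=> [t [y [t0 t1 Cy ->]]]; exists (t, y) => //=; split=> //=; rewrite in_itv /= t0.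
  move=> [[t y] [/= ht Cy] <-]; exists t, y; split=> //.
    by move: ht; rewrite in_itv /= => /andP[].
  by move: ht; rewrite in_itv /= => /andP[].
apply: continuous_compact; last by apply: compact_setX => //; exact: segment_compact.
apply: continuous_subspaceT => p; apply: cvgD; apply: cvgZ.
- exact: cvg_fst.
- exact: cst_continuous.
- by apply: continuousB; [exact: cst_continuous|exact: cvg_fst].
- exact: cvg_snd.
Qed.

Lemma compact_hull (R : realType) (d : nat) (s : seq 'rV[R]_d) : (0 < size s)%N ->
  exists H : set 'rV[R]_d, [/\ convex_set_Rd H, compact H, forall x, x \in s -> H x &
    forall C, convex_set_Rd C -> (forall x, x \in s -> C x) -> H `<=` C].
Proof.
elim: s => [//|x [|y s] IH] _.
  exists [set x]; split; last by move=> C _ h _ ->; apply: h; rewrite inE.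
  - by move=> _ _ -> -> t _ _ /=; rewrite -scalerDl addrC subrK scale1r.
  - exact: compact_set1.
  - by move=> z; rewrite inE => /eqP.
have [//|H [cH kH sH mH]] := IH.
exists [set z | exists t y, [/\ 0 <= t, t <= 1, H y & z = t *: x + (1 - t) *: y]]; split.
- exact: convex_join.
- exact: compact_join.
- move=> z; rewrite in_cons => /predU1P[->|zs] /=.
    by exists 1, y; split=> //; [apply: sH; exact: mem_head|rewrite subrr scale0r addr0 scale1r].
  by exists 0, z; split=> //; [exact: sH|rewrite scale0r add0r subr0 scale1r].
move=> C cC hC _ [t [u [t0 t1 Hu ->]]]; apply: (cC) => //; first by apply: hC; exact: mem_head.
by apply: (mH C cC _ _ Hu) => z zs; apply: hC; rewrite in_cons zs orbT.
Qed.

Lemma coord_le_edist (R : realType) (d : nat) (x y : 'rV[R]_d) (i : 'I_d) :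
  `|x ord0 i - y ord0 i| <= Defs.edist x y.
Proof.
rewrite -sqrtr_sqr /Defs.edist ler_wsqrtr // (bigD1 i) //= lerDl.
by apply: sumr_ge0 => j _; exact: sqr_ge0.
Qed.

Lemma diam_ge (R : realType) (d : nat) (C : set 'rV[R]_d) (x y : 'rV[R]_d) (i : 'I_d) (v : R) :
  C x -> C y -> v <= `|x ord0 i - y ord0 i| -> (v%:E <= diam C)%E.
Proof.
move=> Cx Cy h; apply: le_ereal_sup_tmp; exists (Defs.edist x y)%:E; first by exists x, y.
by rewrite lee_fin (le_trans h) // coord_le_edist.
Qed.

Lemma diam_wide (R : realType) (n : nat) (C : set 'rV[R]_n.+1) :
  (1%:E <= diam C)%E -> wide (2 * n.+1%:R)^-1 C.
Proof.
(* The supremum need not be attained, so only a pair more than 1/2 apart is taken; were all n + 1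
   differences below [c], its distance would be at most 1/2. *)
move=> h; have /ereal_sup_gt[_ [x [y [Cx [Cy ->]]]]] : ((2^-1)%:E < diam C)%E.
  by apply: lt_le_trans h; rewrite lte_fin; lra.
rewrite lte_fin => hxy; exists x, y; apply: contrapT => /forallNP hi.
set c := (2 * n.+1%:R)^-1 in hi.
have n0 : 0 < n.+1%:R :> R by rewrite ltr0n.
have c0 : 0 < c by rewrite invr_gt0 mulr_gt0.
have hs : \sum_(i < n.+1) (x ord0 i - y ord0 i) ^+ 2 <= (2^-1) ^+ 2.
  apply: (@le_trans _ _ (\sum_(i < n.+1) c ^+ 2)).
    apply: ler_sum => i _; rewrite -real_normK ?num_real // lerXn2r ?nnegrE ?(ltW c0) //.
    by rewrite leNgt; apply/negP => lt; apply: (hi i); do 2 split=> //; exact: ltW.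
  rewrite sumr_const card_ord -[_ *+ n.+1]mulr_natl.
  have -> : n.+1%:R * c ^+ 2 = (2^-1) ^+ 2 * n.+1%:R^-1 by rewrite /c; field; rewrite gt_eqF.
  by rewrite ler_piMr ?sqr_ge0 // invf_le1 // ler1n.
move: hxy; rewrite ltNge => /negP; apply.
by rewrite (le_trans (ler_wsqrtr hs)) // sqrtr_sqr ger0_norm.
Qed.

(** Bounds (2/3)^(2k) by 1/k, converting a density into the form used by [weak_net]. *)
Lemma expn_2_3_ratio (k : nat) : (2 ^ (2 * k) * k <= 3 ^ (2 * k))%N.
Proof.
have gen s : (2 ^ s * (2 + s) <= 2 * 3 ^ s)%N by elim: s => [|s IH] //; rewrite !expnS; nia.
have := gen (2 * k)%N; nia.
Qed.

Lemma bigcapF1 (R : realType) (d : nat) (I : finType) (F : I -> set 'rV[R]_d) (i : I) :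
  bigcapF F [set i]%SET = F i.
Proof.
apply/seteqP; split=> x; first by move=> h; apply: h; rewrite inE.
by move=> Fx j; rewrite inE => /eqP ->.
Qed.

(* Replace each set by the hull of finitely many points witnessing all the wide intersections. *)
Lemma compact_reduction (R : realType) (n : nat) (I : finType) (F : I -> set 'rV[R]_n.+1) :
  (0 < #|I|)%N -> (forall i, convex_set_Rd (F i)) -> (forall i, (1%:E <= diam (F i))%E) ->
  exists (W : set 'rV[R]_n.+1) (H : I -> set 'rV[R]_n.+1),
    [/\ convex_set_Rd W, compact W, forall i, convex_set_Rd (H i) /\ compact (H i),
     forall i, H i `<=` F i &
     forall K : {set I}, (1%:E <= diam (bigcapF F K))%E ->
       wide (2 * n.+1%:R)^-1 (cap W H K)].
Proof.
move=> /card_gt0P[i0 _] cvF dF.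
pose good (K : {set I}) := `[< (1%:E <= diam (bigcapF F K))%E >].
have : forall K, exists z : 'rV[R]_n.+1 * 'rV[R]_n.+1, good K ->
    bigcapF F K z.1 /\ bigcapF F K z.2 /\
    exists i, (2 * n.+1%:R)^-1 <= `|z.1 ord0 i - z.2 ord0 i|.
  move=> K; have [gK|gK] := boolP (good K); last by exists (0, 0).
  have /asboolP/diam_wide[x [y [i [Kx [Ky h]]]]] := gK.
  by exists (x, y) => _; split=> //; split=> //; exists i.
move=> /choice[z hz].
have g1 i : good [set i]%SET by apply/asboolP; rewrite bigcapF1.
pose pts (P : pred {set I}) := flatten [seq [:: (z K).1; (z K).2] | K <- enum P].
have ptsP (P : pred {set I}) x : x \in pts P -> exists2 K, P K & x = (z K).1 \/ x = (z K).2.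
  move=> /flatten_mapP[K]; rewrite mem_enum => PK; rewrite !inE => /orP[]/eqP ->.
    by exists K; [|left].
  by exists K; [|right].
have in_pts (P : pred {set I}) K : P K -> (z K).1 \in pts P /\ (z K).2 \in pts P.
  by move=> PK; split; apply/flatten_mapP; exists K; rewrite ?mem_enum // !inE eqxx ?orbT.
have size_pts (P : pred {set I}) K : P K -> (0 < size (pts P))%N.
  by move=> /in_pts[]; case: (pts P).
(* [W] is spanned by all witnesses and [H i] by those of the index sets containing [i]; the
   singletons ensure that no list is empty. *)
have [W [cvW cpW inW _]] := compact_hull (size_pts good _ (g1 i0)).
pose PI i : pred {set I} := fun K => good K && (i \in K).
have hull i := compact_hull (size_pts (PI i) [set i]%SET ltac:(by rewrite /PI g1 inE eqxx)).
have [H hH] := choice hull.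
exists W, H; split=> //; first by move=> i; have [] := hH i.
  move=> i; have [_ _ _ h] := hH i; apply: h => // x /ptsP[K /andP[gK iK]].
  by have [h1 [h2 _]] := hz K gK; case=> ->; [exact: h1|exact: h2].
move=> K /asboolP gK; have [_ [_ [i hi]]] := hz K gK.
have [w1 w2] := in_pts good K gK.
exists (z K).1, (z K).2, i; split; [|split=> //]; split; try exact: inW.
  move=> j jK; have [_ _ h _] := hH j; apply: h.
  by have [] := in_pts (PI j) K (introT andP (conj gK jK)).
move=> j jK; have [_ _ h _] := hH j; apply: h.
by have [] := in_pts (PI j) K (introT andP (conj gK jK)).
Qed.

(** Averaging runs over tuples with repetitions, while the hypothesis speaks of distinct sets:
    either one entry occurs more than [m] times, or more than [p] distinct ones occur. *)
Lemma repeated_or_distinct (I : finType) (p m : nat) (u : seq I) (P : {set I} -> Prop) :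
  size u = (m * p).+1 -> (forall i, P [set i]%SET) ->
  (forall J : {set I}, #|J| = p.+1 -> exists K : {set I}, K \subset J /\ #|K| = m.+1 /\ P K) ->
  exists t, subseq t u /\ size t = m.+1 /\ P [set x in t]%SET.
Proof.
move=> su P1 PJ.
have [[i hi]|rep] := pselect (exists i, (m < count_mem i u)%N).
  exists (nseq m.+1 i); split.
    have -> : nseq m.+1 i = take m.+1 [seq x <- u | x == i].
      have -> : [seq x <- u | x == i] = nseq (count_mem i u) i.
        by rewrite -size_filter; apply/all_pred1P/filter_all.
      by rewrite take_nseq // ltnW.
    exact: subseq_trans (take_subseq _ _) (filter_subseq _ _).
  rewrite size_nseq; split=> //; rewrite (_ : [set x in _]%SET = [set i]%SET) //.
  by apply/setP => x; rewrite !inE mem_nseq; case: (x == i); rewrite ?andbF.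
have hu : (p < size (undup u))%N.
  rewrite ltnNge; apply/negP => h; move: su.
  rewrite -(perm_size (perm_count_undup u)) size_flatten /shape -map_comp sumnE big_map /=.
  under eq_bigr do rewrite size_nseq; move=> e.
  have : ((m * p).+1 <= \sum_(i <- undup u) m)%N.
    rewrite -e; apply: leq_sum => x _; rewrite leqNgt.
    by apply/negP => hx; apply: rep; exists x.
  by rewrite big_const_seq count_predT iter_addn_0 ltnNge leq_mul2l h orbT.
have ut : uniq (take p.+1 (undup u)) by apply: take_uniq; exact: undup_uniq.
have [|K [KJ [cK PK]]] := PJ [set x in take p.+1 (undup u)]%SET.
  by rewrite cardsE (card_uniqP ut) size_takel.
exists [seq x <- undup u | x \in K]; split.
  exact: subseq_trans (filter_subseq _ _) (undup_subseq _).
have KE : [set x in [seq x <- undup u | x \in K]]%SET = K.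
  apply/setP => x; rewrite inE mem_filter; case xK: (x \in K) => //=.
  by have /fintype.subsetP/(_ x xK) := KJ; rewrite inE => /mem_take.
split; last by rewrite KE.
by rewrite -cK -[in RHS]KE cardsE; apply/esym/card_uniqP/filter_uniq/undup_uniq.
Qed.

Lemma exists_large_class (C : finType) (Z : Type) (h : Z -> bool) (cl : C -> Z -> bool) (s : seq Z) :
  (forall z, h z -> exists c, cl c z) -> (0 < #|C|)%N ->
  exists c, (count h s <= #|C| * count (fun z => h z && cl c z) s)%N.
Proof.
move=> hc C0; apply: contrapT => /forallNP hn.
have hs : (count h s <= \sum_c count (fun z => h z && cl c z) s)%N.
  elim: s {hn} => [|z s IH] //=; rewrite big_split leq_add //.
  case hz: (h z) => //; have [c hcz] := hc z hz.
  by rewrite (bigD1 c) //= hcz.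
have : (\sum_(c : C) (#|C| * count (fun z => h z && cl c z) s).+1 <= \sum_(c : C) count h s)%N.
  by apply: leq_sum => c _; rewrite ltnNge; apply/negP/hn.
have const k : (\sum_(c : C) k = #|C| * k)%N by rewrite sum_nat_const.
rewrite const; under eq_bigr do rewrite -addn1.
rewrite big_split const muln1 /= -big_distrr /= => h1.
move: h1; apply/negP; rewrite -ltnNge.
apply: (@leq_ltn_trans (#|C| * \sum_c count (fun z => h z && cl c z) s)).
  by rewrite leq_mul2l hs orbT.
by rewrite -[X in (X < _)%N]addn0 ltn_add2l.
Qed.

(** Taken as an intersection of convex sets, so that containment in any convex set through [x] and
    [y] is immediate. *)
Definition segment_hull (R : realType) (d : nat) (x y : 'rV[R]_d) : set 'rV[R]_d :=
  [set z | forall C, convex_set_Rd C -> C x -> C y -> C z].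

Lemma convex_segment_hull (R : realType) (d : nat) (x y : 'rV[R]_d) :
  convex_set_Rd (segment_hull x y).
Proof. by move=> a b ha hb t t0 t1 C cC Cx Cy; apply: (cC); [exact: ha|exact: hb| |]. Qed.

(** A pair becomes one point of dimension [d + d]. Fixing the coordinate and the sign makes the
    spread condition linear, hence convex. *)
Lemma convex_pairs (R : realType) (d : nat) (F : set 'rV[R]_d) (i : 'I_d) (s : bool) (v : R) :
  convex_set_Rd F -> convex_set_Rd [set u : 'rV[R]_(d + d) | [/\ F (lsubmx u), F (rsubmx u) &
    v <= (-1) ^+ s * (lsubmx u ord0 i - rsubmx u ord0 i)]].
Proof.
move=> cF x y [/= x1 x2 xv] [y1 y2 yv] t t0 t1 /=; rewrite !linearD !linearZ /=.
split; [exact: cF|exact: cF|].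
rewrite !mxE in xv yv *.
have h1 := ler_wpM2l t0 xv.
have t1' : 0 <= 1 - t by lra.
have h2 := ler_wpM2l t1' yv.
nra.
Qed.

(** * Piercing by pairs *)

Lemma spread_pairs_transversal (R : realType) (n q : nat) : exists r : nat,
  forall (I : finType) (W : set 'rV[R]_n.+1) (H : I -> set 'rV[R]_n.+1) (v : R), 0 < v ->
  (0 < #|I|)%N -> convex_set_Rd W -> compact W ->
  (forall k, convex_set_Rd (H k) /\ compact (H k)) ->
  (forall u : seq I, size u = q -> exists t, subseq t u /\ size t = n.+2 /\
     wide (2 * (n.+3%:R * v)) (cap W H [set x in t]%SET)) ->
  exists N : seq 'rV[R]_(n.+1 + n.+1), (size N <= r)%N /\
    forall k, exists u j, [/\ u \in N, H k (lsubmx u), H k (rsubmx u) &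
      v <= `|lsubmx u ord0 j - rsubmx u ord0 j|].
Proof.
have [Q [Q0 hQ]] := weighted_pair R n q.
(* In [m], the factor [4 * Q] comes from the fractional transversal and [#|C|] from passing to one
   coordinate and sign. *)
pose C : finType := ('I_n.+1 * bool)%type; pose m := (4 * Q * #|C|)%N.
have [r hr] := weak_net R (2 * m) (leqnn (n.+1 + n.+1)).
exists r => I W H v v0 I0 cvW cpW cH hq.
pose hit (z : 'rV[R]_n.+1 * 'rV[R]_n.+1) k := `[< H k z.1 /\ H k z.2 /\
  exists j, v <= `|z.1 ord0 j - z.2 ord0 j| >].
have [|Z [Z0 hZ]] := fractional_transversal (hit := hit) I0 Q0.
  move=> w w0.
  have [x [y [j [xy hw]]]] := hQ I W H v v0 cvW cpW (fun k => (cH k).1) (fun k => (cH k).2) hq w w0.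
  exists (x, y); apply: leq_trans hw _; rewrite leq_mul2l; apply/orP; right.
  rewrite [leqLHS]big_mkcond [leqRHS]big_mkcond; apply: leq_sum => k _.
  case: asboolP => // -[Hx Hy]; rewrite /hit; case: asboolP => // h.
  by exfalso; apply: h; split=> //; split=> //; exists j.
have [||N [sN hN]] := hr [seq row_mx z.1 z.2 | z <- Z].
- by rewrite size_map.
- by move=> x y _ _ j; rewrite leqNgt ltn_ord.
exists N; split=> // k.
pose cl (c : C) (z : 'rV[R]_n.+1 * 'rV[R]_n.+1) : bool :=
  v <= (-1) ^+ c.2 * (z.1 ord0 c.1 - z.2 ord0 c.1).
have [||[j s] hc] := exists_large_class (h := hit^~ k) (cl := cl) Z.
- move=> z /asboolP[_ [_ [j hj]]].
  move: hj; rewrite ler_normr => /orP[hj|hj].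
    by exists (j, false); rewrite /cl expr0 mul1r.
  by exists (j, true); rewrite /cl expr1 mulN1r.
- by rewrite card_prod card_ord card_bool.
have [|u [uN /= [Hl Hr hv]]] := hN _ (convex_pairs (i := j) (s := s) (v := v) (cH k).1).
  rewrite size_map count_map.
  set c := count _ Z; apply: (@leq_trans (2 ^ (2 * m) * (m * c))%N).
    rewrite leq_mul2l; apply/orP; right; apply: leq_trans (hZ k) _.
    rewrite /m -!mulnA !leq_mul2l /=; apply/orP; right; apply: leq_trans hc _.
    rewrite leq_mul2l; apply/orP; right; apply: sub_count => z /=.
    move=> /andP[/asboolP[Hx [Hy _]] hz]; apply/asboolP; rewrite row_mxKl row_mxKr.
    by split.
  by rewrite mulnA leq_mul2r expn_2_3_ratio orbT.
exists u, j; split=> //; apply: le_trans hv _.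
by rewrite (le_trans (ler_norm _)) // normrM normrX normrN1 expr1n mul1r.
Qed.

Theorem theorem5 (R : realType) :
  forall d : nat, (0 < d)%N ->
  exists v : R, 0 < v /\
  forall p : nat, (d.+1 <= p)%N ->
  exists r : nat,
  forall (I : finType) (F : I -> set 'rV[R]_d),
    (forall i, convex_set_Rd (F i)) ->
    (forall i, (1%:E <= diam (F i))%E) ->
    (forall J : {set I}, #|J| = p ->
       exists K : {set I}, K \subset J /\ #|K| = d.+1 /\
         (1%:E <= diam (bigcapF F K))%E) ->
    exists C : 'I_r -> set 'rV[R]_d,
      (forall j, convex_set_Rd (C j)) /\
      (forall j, (v%:E <= diam (C j))%E) /\
      (forall i, exists j, C j `<=` F i).
Proof.
(* With d = n + 1, the choice v = 1/(4d(d + 2)) makes 2(n + 3)v equal to 1/(2d), the coordinate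
   width that diameter 1 guarantees. *)
move=> [//|n] _; pose v : R := (4 * n.+1%:R * n.+3%:R)^-1.
have n1 : 0 < n.+1%:R :> R by rewrite ltr0n.
have n3 : 0 < n.+3%:R :> R by rewrite ltr0n.
have v0 : 0 < v by rewrite invr_gt0 !mulr_gt0.
have ve : 2 * (n.+3%:R * v) = (2 * n.+1%:R)^-1 by rewrite /v; field; rewrite !gt_eqF.
exists v; split=> // -[//|p] _.
(* The given number is now p + 1; a tuple of this length with no entry occurring more than n + 1
   times has p + 1 distinct entries. *)
have [r hr] := spread_pairs_transversal R n (n.+1 * p).+1.
exists r => I F cvF dF pF.
have cT : convex_set_Rd [set: 'rV[R]_n.+1] by [].
have dT : (v%:E <= diam [set: 'rV[R]_n.+1])%E.
  apply: (@diam_ge _ _ _ (v *: delta_mx ord0 ord0) 0 ord0) => //.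
  by rewrite !mxE !eqxx mulr1 subr0 ler_norm.
have [I0|I0] := leqP #|I| 0.
  exists (fun _ => setT); split=> //; split=> // i.
  by move: I0; rewrite leqn0 => /eqP/card0_eq/(_ i); rewrite inE.
have [W [H [cvW cpW cH HF hw]]] := compact_reduction I0 cvF dF.
have [|N [sN hN]] := hr I W H v v0 I0 cvW cpW cH.
  move=> u su.
  apply: (repeated_or_distinct (P := fun K => wide (2 * (n.+3%:R * v)) (cap W H K)) su).
    by move=> i; rewrite ve; apply: hw; rewrite bigcapF1.
  by move=> J /pF[K [KJ [cK dK]]]; exists K; rewrite ve; split=> //; split=> //; exact: hw.
(* [N] may be shorter than [r] or contain pairs that are not spread; such indices receive the whole
   space, whose diameter is large. *)
pose u (j : 'I_r) := nth 0 N j.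
pose spread (x : 'rV[R]_(n.+1 + n.+1)) :=
  `[< exists i, v <= `|lsubmx x ord0 i - rsubmx x ord0 i| >].
exists (fun j => if spread (u j) then segment_hull (lsubmx (u j)) (rsubmx (u j)) else setT).
split; first by move=> j; case: ifP => // _; exact: convex_segment_hull.
split.
  move=> j; case: ifP => // /asboolP[i hi].
  by apply: diam_ge hi; move=> C.
move=> i; have [x [j [xN Hl Hr hx]]] := hN i.
have ir : (index x N < r)%N by apply: leq_trans sN; rewrite index_mem.
exists (Ordinal ir); rewrite /u /= nth_index //.
have -> : spread x by apply/asboolP; exists j.
by move=> z hz; apply: HF; apply: hz; [exact: (cH i).1| |].
Qed.
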